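(* For every nonnegative integer $d$ there exists a constant $C_d>0$, depending only on $d$, such that the following holds. Let $n\ge d$ ($n\geq 1$) and $r\ge 0$ be integers with $(r+1)/n\le 1/2$, and let $f\in\mathbb{R}[x_1,\dots,x_n]$ be a polynomial of degree $d$ that is not identically zero on $\{0,1\}^n$. Then $$\frac{f^{(r)}-f_{\min}}{\|f\|_\infty}\le C_d\cdot \xi^n_{r+1}/n .$$
   Context: Write $\mathbb{B}^n=\{0,1\}^n$, $f_{\min}=\min_{x\in\mathbb{B}^n}f(x)$ and $\|f\|_\infty=\max_{x\in\mathbb{B}^n}|f(x)|$. Let $\mu$ be the uniform probability measure on $\mathbb{B}^n$. $\Sigma_r$ denotes the set of sum-of-squares polynomials of degree at most $2r$, i.e. finite sums $\sum_i p_i^2$ with $p_i\in\mathbb{R}[x]$ of degree at most $r$. The inner Lasserre (upper) bound of order $r$ is $$f^{(r)}:=\inf_{s\in\Sigma_r}\Big\{\int_{\mathbb{B}^n}f(x)s(x)\,d\mu(x):\int_{\mathbb{B}^n}s(x)\,d\mu(x)=1\Big\}.$$ The Krawtchouk polynomial of degree $k$ with parameter $n$ is the univariate polynomial $\mathcal{K}^n_k(t)=\sum_{i=0}^k(-1)^i\binom{t}{i}\binom{n-t}{k-i}$. For $1\le k\le n$, $\xi^n_k$ denotes its least (smallest real) root. *)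

(* Defs.v *)
From HB Require Import structures.
From mathcomp Require Import all_boot all_order all_algebra.
From mathcomp Require Import boolp classical_sets reals mpoly.
Set Implicit Arguments.
Unset Strict Implicit.
Unset Printing Implicit Defensive.
Import Order.TTheory GRing.Theory Num.Theory.
Local Open Scope classical_set_scope.
Local Open Scope ring_scope.

Definition cube (n : nat) := {ffun 'I_n -> bool}.

Definition cube_eval (R : realType) (n : nat) (f : {mpoly R[n]})
    (x : cube n) : R :=
  f.@[fun i => (x i)%:R].

(* The initial value of the iterated minimum is itself a value of f on the
   cube, so this is the minimum of f over the cube. *)
Definition cube_min (R : realType) (n : nat) (f : {mpoly R[n]}) : R :=
  \big[Num.min/cube_eval f [ffun=> false]]_(x : cube n) cube_eval f x.

Definition cube_norm (R : realType) (n : nat) (f : {mpoly R[n]}) : R :=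
  \big[Num.max/0]_(x : cube n) `|cube_eval f x|.

(* The integral against the uniform probability measure on {0,1}^n. *)
Definition cube_integral (R : realType) (n : nat) (f : {mpoly R[n]}) : R :=
  (\sum_(x : cube n) cube_eval f x) / #|{: cube n}|%:R.

(* msize is the total degree plus one (and 0 for the zero polynomial). *)
Definition sos (R : realType) (n r : nat) (s : {mpoly R[n]}) : Prop :=
  exists ps : seq {mpoly R[n]},
    (forall p, p \in ps -> (msize p <= r.+1)%N) /\
    s = \sum_(p <- ps) p ^+ 2.

(* The constraint set is nonempty (s = 1) and the objective is bounded below on
   it by the minimum of f on the cube, so the junk value of inf never occurs. *)
Definition lasserre_inner (R : realType) (n : nat) (f : {mpoly R[n]})
    (r : nat) : R :=
  inf [set cube_integral (f * s) | s in
        [set s : {mpoly R[n]} | sos r s /\ cube_integral s = 1]].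

(* The binomial coefficient (q choose i) as a polynomial:
   q (q - 1) ... (q - i + 1) / i!. *)
Definition binom_poly (R : realType) (q : {poly R}) (i : nat) : {poly R} :=
  (i`!%:R)^-1 *: \prod_(j < i) (q - (j%:R)%:P).

Definition krawtchouk (R : realType) (n k : nat) : {poly R} :=
  \sum_(i < k.+1)
    (-1) ^+ i * binom_poly 'X i * binom_poly (n%:R%:P - 'X) (k - i).

(* The junk value is 0 when p has no least real root. *)
Definition least_root (R : realType) (p : {poly R}) : R :=
  xget 0 [set x | root p x /\ forall y, root p y -> x <= y].

Definition krawtchouk_least_root (R : realType) (n k : nat) : R :=
  least_root (krawtchouk R n k).

(* Main.v *)
(* Let a be a minimizer of f on the cube and take the sum of squares to be q^2,
   with q a univariate polynomial of degree at most r in the Hamming distance t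
   to a.  Averaging f over the spheres around a gives a polynomial F of degree at
   most d in t with F(0) = f_min and |F| <= ||f|| on {0, ..., n}; as n >= d, this
   forces F(t) - F(0) <= A_d ||f|| t / n on {0, ..., n}.  It remains to make the
   mean of t under the weights 'C(n, t) q(t)^2 small: since the Krawtchouk
   polynomials are orthogonal for the weights 'C(n, t), the choice
   q = K_(r+1) / (X - xi) makes this mean equal to the least root xi of
   K_(r+1). *)
Require Import Defs.
From mathcomp Require Import all_boot all_order all_algebra.
From mathcomp Require Import boolp classical_sets reals mpoly.
From mathcomp Require Import ring lra zify.
Set Implicit Arguments.
Unset Strict Implicit.
Import Order.TTheory GRing.Theory Num.Theory.
Local Open Scope ring_scope.

(** * Lipschitz estimates for polynomials bounded at integer points *)

Lemma split_constant_term (R : nzRingType) (p : {poly R}) :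
  exists2 q : {poly R}, p = q * 'X + p.[0]%:P & (size q <= (size p).-1)%N.
Proof.
exists (drop_poly 1 p); last by rewrite size_drop_poly subn1.
rewrite -{1}[p](poly_take_drop 1) expr1 addrC; congr (_ + _).
by rewrite [take_poly 1 p]size1_polyC ?size_take_poly // coef_take_poly /= horner_coef0.
Qed.

(* With p = p(0) + X q, the values of q on 1, ..., e are at most 2 M, so that
   the induction hypothesis applies to q(X + 1). *)
Lemma poly_grid_lipschitz (R : realFieldType) (e : nat) (B : R) : 0 <= B ->
  exists2 A : R, 0 <= A & forall (p : {poly R}) (M : R),
    (size p <= e.+1)%N -> (forall j : nat, (j <= e)%N -> `|p.[j%:R]| <= M) ->
    forall s, `|s| <= B -> `|p.[s] - p.[0]| <= A * M * `|s|.
Proof.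
elim: e B => [|e IHe] B B_ge0.
  exists 0 => // p M /size1_polyC -> _ s _.
  by rewrite !hornerC subrr normr0 !mul0r.
(* The shifted quotient is evaluated at [s - 1], which lies within radius [B + 1]. *)
have [|A A_ge0 IH] := IHe (B + 1); first lra.
(* Comes from |q(s)| <= |q(1)| + A (2 M) |s - 1| <= 2 M (1 + A (B + 1)). *)
exists (2 * (1 + A * (B + 1))).
  by rewrite mulr_ge0 // addr_ge0 // mulr_ge0 // addr_ge0.
move=> p M size_p pM s sB.
have [q p_eq size_q] := split_constant_term p.
have M_ge0 : 0 <= M by apply: le_trans (pM 0%N _).
have pE x : p.[x] - p.[0] = q.[x] * x.
  by rewrite {1}p_eq hornerD hornerC hornerMX addrK.
have size_q1 : (size (q \Po ('X + 1%:P)) <= e.+1)%N.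
  rewrite size_comp_poly2; first by apply: leq_trans size_q _; case: (size p) size_p.
  by rewrite size_XaddC.
have q1E x : (q \Po ('X + 1%:P)).[x] = q.[x + 1].
  by rewrite horner_comp hornerD hornerX hornerC.
have q1M j : (j <= e)%N -> `|(q \Po ('X + 1%:P)).[j%:R]| <= 2 * M.
  move=> le_je; rewrite q1E natr1.
  have jS : `|q.[j.+1%:R]| * j.+1%:R <= 2 * M.
    rewrite -[X in _ * X <= _](@ger0_norm _ j.+1%:R) ?ler0n // -normrM -pE.
    apply: le_trans (ler_normB _ _) _.
    by rewrite mulr2n mulrDl mul1r lerD ?pM //; apply: (pM 0%N).
  apply: le_trans jS; rewrite ler_peMr //.
  by rewrite ler1n.
have q1_lip := IH _ _ size_q1 q1M.
have q_bound x : `|x| <= B -> `|q.[x]| <= 2 * M * (1 + A * (B + 1)).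
  move=> xB.
  have x1B : `|x - 1| <= B + 1.
    by apply: le_trans (ler_normB _ _) _; rewrite normr1 lerD2r.
  have := q1_lip (x - 1) x1B; rewrite !q1E subrK add0r => lip.
  have q1 := q1M 0%N isT; rewrite q1E add0r in q1.
  rewrite -[q.[x]](subrK q.[1]).
  apply: le_trans (ler_normD _ _) _.
  have : A * (2 * M) * `|x - 1| <= A * (2 * M) * (B + 1).
    by rewrite ler_wpM2l // !mulr_ge0.
  lra.
rewrite pE normrM ler_wpM2r //.
by apply: le_trans (q_bound _ sB) _; rewrite le_eqVlt; apply/orP; left; apply/eqP; ring.
Qed.

(** With d' = max(d, 1) and m = n %/ d', the points 0, m, ..., d m lie in {0, ..., n}, so p(m X) is
    bounded by M on 0, ..., d. The points t / m stay in an interval depending on d only, where the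
    grid estimate applies; the factor 1 / n comes from 1 / m <= 2 d' / n. *)
Lemma poly_discrete_lipschitz (R : realFieldType) (d : nat) :
  exists2 A : R, 0 <= A & forall (n : nat) (p : {poly R}) (M : R),
    (0 < n)%N -> (d <= n)%N -> (size p <= d.+1)%N ->
    (forall t : nat, (t <= n)%N -> `|p.[t%:R]| <= M) ->
    forall t : nat, (t <= n)%N -> p.[t%:R] - p.[0] <= A * M * (t%:R / n%:R).
Proof.
set d' := maxn d 1.
have d'_gt0 : (0 < d')%N by rewrite leq_max orbT.
have [|A A_ge0 HA] := @poly_grid_lipschitz R d (2 * d')%:R; first exact: ler0n.
exists (A * (2 * d')%:R); first by rewrite mulr_ge0.
move=> n p M n_gt0 le_dn size_p pM t le_tn.
have le_d'n : (d' <= n)%N by rewrite geq_max le_dn.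
set m := (n %/ d')%N.
have m_gt0 : (0 < m)%N by rewrite divn_gt0.
have mR_gt0 : 0 < m%:R :> R by rewrite ltr0n.
have nR_gt0 : 0 < n%:R :> R by rewrite ltr0n.
(* Here n < d' m + d' <= 2 d' m, as m >= 1. *)
have le_n : (n <= 2 * d' * m)%N.
  rewrite {1}(divn_eq n d') -/m mulnC -mulnA mul2n -addnn leq_add2l.
  by apply: leq_trans (ltnW (ltn_pmod _ d'_gt0)) _; rewrite leq_pmulr.
pose q := p \Po (m%:R *: 'X).
have qE x : q.[x] = p.[m%:R * x] by rewrite horner_comp hornerZ hornerX.
have size_q : (size q <= d.+1)%N.
  by rewrite size_comp_poly2 // size_scale ?size_polyX // gt_eqF.
have M_ge0 : 0 <= M by apply: le_trans (pM 0%N _).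
have q_bound j : (j <= d)%N -> `|q.[j%:R]| <= M.
  move=> le_jd; rewrite qE -natrM pM //.
  rewrite mulnC (leq_trans _ (leq_trunc_div n d')) // mulnC leq_mul2l.
  by rewrite (leq_trans le_jd) ?orbT // leq_maxl.
have le_tm : t%:R / m%:R <= (2 * d')%:R / n%:R * t%:R :> R.
  rewrite ler_pdivrMr // [leRHS](_ : _ = t%:R * ((2 * d' * m)%:R / n%:R)).
    by rewrite ler_peMr // ler_pdivlMr // mul1r ler_nat.
  by rewrite !natrM; field; rewrite gt_eqF.
have tmB : `|t%:R / m%:R| <= (2 * d')%:R :> R.
  rewrite ger0_norm ?divr_ge0 ?ler0n //; apply: le_trans le_tm _.
  by rewrite mulrAC ler_pdivrMr // -!natrM ler_nat leq_mul2l le_tn orbT.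
have := HA q M size_q q_bound _ tmB.
rewrite !qE mulr0 mulrCA divff ?gt_eqF // mulr1 => lip.
apply: le_trans (ler_norm _) (le_trans lip _).
rewrite ger0_norm ?divr_ge0 ?ler0n // [leRHS](_ : _ = A * M * ((2 * d')%:R / n%:R * t%:R)).
  by rewrite ler_wpM2l // mulr_ge0.
by field; rewrite gt_eqF.
Qed.

(** * Krawtchouk polynomials: generating function, orthogonality, least root *)

Lemma coef_binomial_power (R : comNzRingType) (c : R) (m k : nat) :
  ((1 + c *: 'X) ^+ m)`_k = c ^+ k *+ 'C(m, k).
Proof.
have -> : (1 + c *: 'X) ^+ m = \poly_(i < m.+1) (c ^+ i *+ 'C(m, i)).
  rewrite exprDn poly_def; apply: eq_bigr => i _.
  by rewrite expr1n mul1r exprZn scalerMnl.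
rewrite coef_poly ltnS; case: leqP => // lt_mk.
by rewrite bin_small // mulr0n.
Qed.

(** Only the value of [q] at [x] is prescribed, so that both ['X] and [n - 'X] are covered. For t <
    i the falling factorial has a zero factor. *)
Lemma horner_binom_poly (R : realType) (q : {poly R}) (i : nat) (x : R) (t : nat) :
  q.[x] = t%:R -> (binom_poly q i).[x] = 'C(t, i)%:R.
Proof.
move=> qx; rewrite /binom_poly hornerZ.
suff -> : (\prod_(j < i) (q - (j%:R)%:P)).[x] = (t ^_ i)%:R.
  by rewrite -bin_ffact natrM mulrCA mulVf ?mulr1 // pnatr_eq0 -lt0n fact_gt0.
elim: i => [|i IHi]; first by rewrite big_ord0 hornerC ffactn0.
rewrite big_ord_recr /= hornerM IHi hornerD hornerN hornerC qx ffactnSr natrM.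
case: (leqP i t) => [le_it|lt_ti]; first by rewrite natrB.
by rewrite ffact_small // !mul0r.
Qed.

Lemma size_binom_poly (R : realType) (q : {poly R}) (i : nat) :
  (size q <= 2)%N -> (size (binom_poly q i) <= i.+1)%N.
Proof.
move=> size_q; apply: leq_trans (size_scale_leq _ _) _.
elim: i => [|i IHi]; first by rewrite big_ord0 size_poly1.
rewrite big_ord_recr /=; apply: leq_trans (size_polyMleq _ _) _.
have size_qi : (size (q - (i%:R)%:P)%R <= 2)%N.
  rewrite (leq_trans (size_polyD _ _)) // geq_max size_q size_polyN.
  by rewrite (leq_trans (size_polyC_leq1 _)).
by rewrite -subn1 leq_subLR (leq_trans (leq_add IHi size_qi)) // addn2.
Qed.

Lemma size_krawtchouk (R : realType) (n k : nat) :
  (size (krawtchouk R n k) <= k.+1)%N.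
Proof.
apply: leq_trans (size_sum _ _ _) _; apply/bigmax_leqP => i _.
rewrite -signr_odd -mulrA mulr_sign.
set p := _ * _.
have -> : size (if odd i then - p else p) = size p by case: ifP; rewrite ?size_polyN.
apply: leq_trans (size_polyMleq _ _) _.
have size_Xi : (size (binom_poly ('X : {poly R}) i) <= i.+1)%N.
  by rewrite size_binom_poly ?size_polyX.
have size_nX : (size (binom_poly (n%:R%:P - 'X : {poly R}) (k - i)) <= (k - i).+1)%N.
  rewrite size_binom_poly // (leq_trans (size_polyD _ _)) // geq_max size_polyN.
  by rewrite size_polyX (leq_trans (size_polyC_leq1 _)).
rewrite -subn1 leq_subLR (leq_trans (leq_add size_Xi size_nX)) //.
by rewrite addSn addnS subnKC // -ltnS.
Qed.

(** The defining sum is the Cauchy product of the coefficients of (1 - X)^t and (1 + X)^(n - t). *)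
Lemma horner_krawtchouk (R : realType) (n k t : nat) : (t <= n)%N ->
  (krawtchouk R n k).[t%:R] = ((1 - 'X) ^+ t * (1 + 'X) ^+ (n - t))`_k.
Proof.
move=> le_tn; rewrite coefM horner_sum; apply: eq_bigr => i _.
have -> : 1 + 'X = 1 + 1 *: 'X :> {poly R} by rewrite scale1r.
have -> : 1 - 'X = 1 + (-1) *: 'X :> {poly R} by rewrite scaleN1r.
have -> : (-1) ^+ i = ((-1) ^+ i)%:P :> {poly R} by rewrite polyC_exp polyCN polyC1.
rewrite !coef_binomial_power.
rewrite !hornerM hornerC.
rewrite (@horner_binom_poly _ _ _ _ t) ?hornerX //.
rewrite (@horner_binom_poly _ _ _ _ (n - t)); last first.
  by rewrite hornerD hornerN hornerX hornerC natrB.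
by rewrite expr1n !mulr_natr.
Qed.
(* On the integer points, k |-> krawtchouk R n k is the generating function
   (1 - z)^t (1 + z)^(n - t).  Summed against the weights 'C(n, t), the factor t
   lowers n to n - 1 and extracts n (1 - z), so p raises the z-degree of the
   total 2^n by at most its own degree. *)
Lemma size_binomial_moment (R : realType) (n : nat) (p : {poly R}) :
  (size (\sum_(t < n.+1) ('C(n, t)%:R * p.[t%:R]) *:
      ((1 - 'X) ^+ t * (1 + 'X) ^+ (n - t)))%R <= size p)%N.
Proof.
have [m] := ubnP (size p); elim: m n p => // m IHm n p; rewrite ltnS => size_p.
have [->|p_neq0] := eqVneq p 0.
  by rewrite big1 ?size_poly0 // => t _; rewrite horner0 mulr0 scale0r.
have p_gt0 : (0 < size p)%N by rewrite size_poly_gt0.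
have [q p_eq size_q] := split_constant_term p.
pose q1 := q \Po ('X + 1%:P).
have size_q1 : size q1 = size q by rewrite size_comp_poly2 // size_XaddC.
have pE (x : R) : p.[x] = p.[0] + q.[x] * x.
  by rewrite {1}p_eq hornerD hornerC hornerMX addrC.
rewrite (eq_bigr (fun t : 'I_n.+1 => p.[0] *: (((1 - 'X) ^+ t * (1 + 'X) ^+ (n - t)) *+ 'C(n, t)) +
   ('C(n, t)%:R * (q.[t%:R] * t%:R)) *: ((1 - 'X) ^+ t * (1 + 'X) ^+ (n - t)))); last first.
  move=> t _; rewrite pE mulrDr scalerDl; congr (_ + _).
  by rewrite mulrC -scalerA scaler_nat.
rewrite big_split /= -scaler_sumr.
rewrite (eq_bigr (fun t : 'I_n.+1 => ((1 + 'X) ^+ (n - t) * (1 - 'X) ^+ t) *+ 'C(n, t))); last first.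
  by move=> t _; rewrite mulrC.
rewrite -exprDn addrACA subrr addr0.
apply: leq_trans (size_polyD _ _) _; rewrite geq_max; apply/andP; split.
  rewrite (leq_trans (size_scale_leq _ _)) //.
  by rewrite -mulr2n -natrX -polyC_natr (leq_trans (size_polyC_leq1 _)).
case: n => [|n]; first by rewrite big_ord_recl big_ord0 !mulr0 scale0r addr0 size_poly0.
rewrite big_ord_recl !mulr0 scale0r add0r.
(* The identity (t + 1) C(n + 1, t + 1) = (n + 1) C(n, t) absorbs the factor; the index shift turns
   [q] into [q1], of the same size, ready for the induction hypothesis. *)
rewrite (eq_bigr (fun t : 'I_n.+1 => (n.+1%:R *: (1 - 'X)) * (('C(n, t)%:R * q1.[t%:R]) *:
   ((1 - 'X) ^+ t * (1 + 'X) ^+ (n - t))))); last first.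
  move=> t _; rewrite lift0 subSS exprS horner_comp hornerD hornerX hornerC natr1.
  rewrite -scalerAr -!scalerAl scalerA -mulrA; congr (_ *: _).
  have := mul_bin_diag n.+1 t => /= bin_diag.
  by rewrite [RHS]mulrC [RHS]mulrA -natrM bin_diag natrM; ring.
rewrite -mulr_sumr.
apply: leq_trans (size_polyMleq _ _) _.
have size_X : (size (n.+1%:R *: (1 - 'X) : {poly R})%R <= 2)%N.
  rewrite (leq_trans (size_scale_leq _ _)) // (leq_trans (size_polyD _ _)) //.
  by rewrite size_poly1 size_polyN size_polyX.
have lt_qp : (size q < size p)%N by rewrite (leq_ltn_trans size_q) // ltn_predL.
have := IHm n q1; rewrite size_q1 => /(_ (leq_trans lt_qp size_p)) IH.
by rewrite -subn1 leq_subLR (leq_trans (leq_add size_X IH)).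
Qed.

(** The sum is the coefficient of X^k in the polynomial of [size_binomial_moment], whose size is at
    most [size p <= k]. *)
Lemma krawtchouk_orthogonal (R : realType) (n k : nat) (p : {poly R}) :
  (size p <= k)%N ->
  \sum_(t < n.+1) 'C(n, t)%:R * p.[t%:R] * (krawtchouk R n k).[t%:R] = 0.
Proof.
move=> size_p.
rewrite -[RHS](nth_default 0 (leq_trans (size_binomial_moment n p) size_p)).
rewrite coef_sum; apply: eq_bigr => t _.
by rewrite coefZ horner_krawtchouk // -ltnS.
Qed.

(** The value at 0 is the coefficient of X^k in (1 + X)^n, which is nonzero for k <= n. *)
Lemma krawtchouk_neq0 (R : realType) (n k : nat) : (k <= n)%N ->
  krawtchouk R n k != 0.
Proof.
move=> le_kn; apply: contraTneq isT => K0.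
have := @horner_krawtchouk R n k 0 isT; rewrite K0 horner0 expr0 mul1r subn0.
have -> : 1 + 'X = 1 + 1 *: 'X :> {poly R} by rewrite scale1r.
rewrite coef_binomial_power expr1n => /eqP.
by rewrite eq_sym pnatr_eq0 -leqn0 leqNgt bin_gt0 le_kn.
Qed.

(** Orthogonality to 1 makes the weighted sum of the values vanish, while a polynomial without roots
    has constant sign by the intermediate value theorem. *)
Lemma krawtchouk_has_root (R : realType) (n k : nat) : (0 < k)%N ->
  exists x : R, root (krawtchouk R n k) x.
Proof.
move=> k_gt0; set K := krawtchouk R n k.
have := @krawtchouk_orthogonal R n k 1; rewrite size_poly1 => /(_ k_gt0).
rewrite (eq_bigr (fun t : 'I_n.+1 => 'C(n, t)%:R * K.[t%:R])); last first.
  by move=> t _; rewrite hornerC mulr1.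
move=> sum0; apply: contrapT => no_root.
have nz x : K.[x] != 0 by apply/negP => /eqP Kx; apply: no_root; exists x; apply/eqP.
have C_gt0 (t : 'I_n.+1) : 0 < 'C(n, t)%:R :> R by rewrite ltr0n bin_gt0 -ltnS.
have same_sign (a b : R) : 0 < K.[a] * K.[b].
  apply: contrapT => /negP; rewrite -leNgt => ab; apply: no_root.
  wlog le_ab : a b ab / a <= b.
    move=> H; case: (leP a b) => [/H|/ltW /H]; first exact.
    by apply; rewrite mulrC.
  case: (leP K.[a] 0) => [Ka|Ka].
    have /(poly_ivt le_ab)[x _ rx] : 0 \in `[K.[a], K.[b]]; last by exists x.
    rewrite in_itv /= Ka /=; move: ab; rewrite nmulr_rle0 //.
    by rewrite lt_neqAle nz.
  have /(poly_ivt le_ab)[x _ rx] : 0 \in `[(- K).[a], (- K).[b]].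
    rewrite in_itv /= !hornerN oppr_le0 oppr_ge0 ltW //=.
    by rewrite -(pmulr_rle0 _ Ka).
  by exists x; rewrite rootN in rx.
(* Multiplying by K(0) makes every term positive, whatever the sign of K. *)
have : 0 < \sum_(t < n.+1) K.[0] * ('C(n, t)%:R * K.[t%:R]).
  rewrite big_ord_recl ltr_pwDl //.
    by rewrite mulrCA mulr_gt0 // (C_gt0 ord0).
  by apply: sumr_ge0 => t _; rewrite mulrCA ltW // mulr_gt0.
by rewrite -mulr_sumr sum0 mulr0 ltxx.
Qed.

(** Induction on the size: split off one root and compare it with the least root of the quotient, if
    there is one. *)
Lemma poly_least_root (R : realDomainType) (p : {poly R}) : p != 0 ->
  (exists x, root p x) ->
  exists x, root p x /\ forall y, root p y -> x <= y.
Proof.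
have [m] := ubnP (size p); elim: m p => // m IHm p; rewrite ltnS => size_p p_neq0 [x rx].
have [q p_eq] := factor_theorem p x rx.
have q_neq0 : q != 0 by apply: contraNneq p_neq0 => q0; rewrite p_eq q0 mul0r.
have [[y ry]|no_root] := pselect (exists y, root q y).
  have [|z [rz z_min]] := IHm q _ q_neq0 (ex_intro _ y ry).
    by move: size_p; rewrite p_eq size_Mmonic ?monicXsubC // size_XsubC addn2.
  exists (Num.min x z); rewrite p_eq; split=> [|w].
    by rewrite rootM root_XsubC minEle; case: ifP => _; rewrite ?rz ?eqxx ?orbT.
  rewrite rootM root_XsubC ge_min => /orP[/z_min ->|/eqP ->]; first by rewrite orbT.
  by rewrite lexx.
exists x; split=> // y; rewrite p_eq rootM root_XsubC => /orP[ry|/eqP -> //].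
by case: no_root; exists y.
Qed.

Lemma root_krawtchouk_least (R : realType) (n k : nat) : (0 < k <= n)%N ->
  root (krawtchouk R n k) (krawtchouk_least_root R n k).
Proof.
case/andP=> k_gt0 le_kn.
have := poly_least_root (krawtchouk_neq0 R le_kn) (krawtchouk_has_root R n k_gt0).
by move=> /(xgetPex 0)[].
Qed.

(* Take q = K_(r+1) / (X - xi), so that (t - xi) q^2 = K_(r+1) q. *)
Lemma krawtchouk_multiplier (R : realType) (n r : nat) : (r < n)%N ->
  exists q : {poly R}, [/\ (size q <= r.+1)%N,
    0 < \sum_(t < n.+1) 'C(n, t)%:R * q.[t%:R] ^+ 2 &
    \sum_(t < n.+1) 'C(n, t)%:R * q.[t%:R] ^+ 2 * t%:R =
    krawtchouk_least_root R n r.+1 *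
      \sum_(t < n.+1) 'C(n, t)%:R * q.[t%:R] ^+ 2].
Proof.
move=> lt_rn; set xi := krawtchouk_least_root _ _ _.
have K_neq0 := krawtchouk_neq0 R lt_rn.
have [q K_eq] := factor_theorem _ _ (@root_krawtchouk_least R n r.+1 lt_rn).
have q_neq0 : q != 0 by apply: contraNneq K_neq0 => q0; rewrite K_eq q0 mul0r.
have size_q : (size q <= r.+1)%N.
  have := size_krawtchouk R n r.+1.
  by rewrite K_eq size_Mmonic ?monicXsubC // size_XsubC addn2.
have ge0 (t : 'I_n.+1) : 0 <= 'C(n, t)%:R * q.[t%:R] ^+ 2.
  by rewrite mulr_ge0 ?sqr_ge0.
exists q; split=> //.
  (* A zero sum would give [q] the n + 1 distinct roots 0, ..., n, too many for a size of at most r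
     + 1 <= n. *)
  rewrite lt_neqAle sumr_ge0 // andbT eq_sym.
  apply: contra q_neq0; rewrite psumr_eq0 // => /allP all0.
  apply/negPn/negP => q_neq0.
  have /(max_poly_roots q_neq0) : all (root q) [seq (val t)%:R | t <- enum 'I_n.+1].
    apply/allP => _ /mapP[t _ ->]; have := all0 t (mem_index_enum t).
    rewrite /= mulf_eq0 sqrf_eq0 pnatr_eq0 => /orP[|//].
    by rewrite -leqn0 leqNgt bin_gt0 -ltnS ltn_ord.
  rewrite map_inj_uniq ?enum_uniq; last first.
    by move=> s t /eqP; rewrite eqr_nat => /eqP/val_inj.
  move=> /(_ isT); rewrite size_map size_enum_ord => lt_nq.
  by have := leq_trans lt_nq size_q; rewrite ltnS ltnNge ltnW.
apply/eqP; rewrite -subr_eq0 mulr_sumr -sumrB; apply/eqP.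
rewrite -[RHS](krawtchouk_orthogonal n size_q); apply: eq_bigr => t _.
by rewrite K_eq hornerM hornerXsubC -/xi; ring.
Qed.

(** * Averages over Hamming spheres *)

Definition cube_weight (n : nat) (x : cube n) : nat := (\sum_i x i)%N.

(** Translation modulo 2, moving [a] to the origin: the weight of [cube_flip a x] is the Hamming
    distance from [a] to [x]. *)
Definition cube_flip (n : nat) (a x : cube n) : cube n := [ffun i => a i (+) x i].

Lemma cube_flipK (n : nat) (a : cube n) : involutive (cube_flip a).
Proof. by move=> x; apply/ffunP => i; rewrite !ffunE addbA addbb. Qed.

Lemma cube_weight_le (n : nat) (x : cube n) : (cube_weight x <= n)%N.
Proof.
rewrite -[leqRHS]card_ord -sum1_card; apply: leq_sum => i _.
exact: leq_b1.
Qed.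

Lemma sum_cube_slices (R : realType) (n : nat) (g : cube n -> R) (h : nat -> R) :
  \sum_x g x * h (cube_weight x) =
  \sum_(t < n.+1) h t * \sum_(x | cube_weight x == t) g x.
Proof.
rewrite (partition_big (fun x => inord (cube_weight x) : 'I_n.+1) xpredT) //=.
apply: eq_bigr => t _; rewrite mulr_sumr; apply: eq_big => x.
  by rewrite -val_eqE /= inordK // ltnS cube_weight_le.
by move=> /eqP <-; rewrite inordK ?ltnS ?cube_weight_le // mulrC.
Qed.

(* The left-hand side is the coefficient of X^t in the product over i of
   1 + X, with 1 + X replaced by X for i in A. *)
Lemma sum_slice_monomial (R : realType) (n : nat) (A : {set 'I_n}) (t : nat) :
  \sum_(x : cube n | cube_weight x == t) \prod_(i in A) (x i)%:R =
  (if (t < #|A|)%N then 0 else 'C(n - #|A|, t - #|A|))%:R :> R.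
Proof.
pose F (i : 'I_n) (b : bool) : {poly R} :=
  (if i \in A then b%:R else 1) *: 'X^b.
have prodF (x : cube n) :
    \prod_i F i (x i) = (\prod_(i in A) (x i)%:R) *: 'X^(cube_weight x).
  by rewrite scaler_prod -big_mkcond prodrXr.
have sumF i : \sum_b F i b = if i \in A then 'X else 1 + 'X.
  rewrite big_bool /F; case: (i \in A); last by rewrite !scale1r addrC.
  by rewrite /= scale1r scale0r addr0.
have : 'X^#|A| * (1 + 'X) ^+ #|[predC A]| =
    \sum_(x : cube n) \prod_(i in A) (x i)%:R *: 'X^(cube_weight x) :> {poly R}.
  rewrite -(eq_bigr _ (fun x _ => prodF x)) -bigA_distr_bigA.
  rewrite (eq_bigr _ (fun i _ => sumF i)) (bigID (mem A)) /= -!prodr_const.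
  by congr (_ * _); apply: eq_bigr => i; [move=> -> | move=> /negPf ->].
move=> /(congr1 (fun p : {poly R} => p`_t)); rewrite coefXnM coef_sum => sum_eq.
have -> : \sum_(x : cube n | cube_weight x == t) \prod_(i in A) (x i)%:R =
  \sum_(x : cube n) (\prod_(i in A) (x i)%:R *: 'X^(cube_weight x) : {poly R})`_t.
  rewrite big_mkcond; apply: eq_bigr => x _.
  by rewrite coefZ coefXn eq_sym; case: eqP; rewrite ?mulr1 ?mulr0.
rewrite -sum_eq; case: ifP => // _.
have -> : 1 + 'X = 1 + 1 *: 'X :> {poly R} by rewrite scale1r.
rewrite coef_binomial_power expr1n; congr (_ *+ 'C(_, _)).
by apply/eqP; rewrite -(eqn_add2l #|A|) cardC card_ord subnKC // -[leqRHS]card_ord max_card.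
Qed.

Lemma card_slice (R : realType) (n t : nat) :
  \sum_(x : cube n | cube_weight x == t) 1 = 'C(n, t)%:R :> R.
Proof.
have := sum_slice_monomial R (finset.set0 : {set 'I_n}) t.
rewrite cards0 ltn0 !subn0 => <-.
by apply: eq_bigr => x _; rewrite big_set0.
Qed.

(** Multiplied by a! (t - a)! (n - t)!, both sides become n!. *)
Lemma bin_subset_of_subset (n t a : nat) : (a <= t <= n)%N ->
  ('C(n, a) * 'C(n - a, t - a) = 'C(n, t) * 'C(t, a))%N.
Proof.
case/andP=> le_at le_tn.
have fact_pos : (0 < a`! * ((t - a)`! * (n - t)`!))%N by rewrite !muln_gt0 !fact_gt0.
apply/eqP; rewrite -(eqn_pmul2r fact_pos); apply/eqP.
have e1 := bin_fact (leq_trans le_at le_tn).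
have e2 : ('C(n - a, t - a) * ((t - a)`! * (n - t)`!) = (n - a)`!)%N.
  rewrite -(bin_fact (leq_sub2r a le_tn)); do 2!congr (_ * _)%N.
  by congr (_`!); lia.
rewrite mulnACA e2 -mulnA e1 -(bin_fact le_tn) -(bin_fact le_at).
by ring.
Qed.

(** Here p(t) is the average of [g] over the sphere of weight t, stated without division. *)
Definition slice_poly (R : realType) (n k : nat) (g : cube n -> R) : Prop :=
  exists2 p : {poly R}, (size p <= k.+1)%N & forall t : nat, (t <= n)%N ->
    \sum_(x | cube_weight x == t) g x = 'C(n, t)%:R * p.[t%:R].

Lemma slice_poly_ext (R : realType) (n k : nat) (g h : cube n -> R) :
  g =1 h -> slice_poly k g -> slice_poly k h.
Proof.
move=> gh [p size_p pE]; exists p => // t /pE <-.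
by apply: eq_bigr => x _; rewrite gh.
Qed.

Lemma slice_poly_le (R : realType) (n k l : nat) (g : cube n -> R) :
  (k <= l)%N -> slice_poly k g -> slice_poly l g.
Proof. by move=> le_kl [p size_p pE]; exists p => //; apply: leq_trans size_p _. Qed.

Lemma slice_polyD (R : realType) (n k : nat) (g h : cube n -> R) :
  slice_poly k g -> slice_poly k h -> slice_poly k (fun x => g x + h x).
Proof.
move=> [p size_p pE] [q size_q qE]; exists (p + q).
  by rewrite (leq_trans (size_polyD _ _)) // geq_max size_p.
by move=> t le_tn; rewrite big_split /= pE // qE // hornerD mulrDr.
Qed.

Lemma slice_polyZ (R : realType) (n k : nat) (c : R) (g : cube n -> R) :
  slice_poly k g -> slice_poly k (fun x => c * g x).
Proof.
move=> [p size_p pE]; exists (c *: p).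
  exact: leq_trans (size_scale_leq _ _) _.
by move=> t le_tn; rewrite -mulr_sumr pE // hornerZ mulrCA.
Qed.

Lemma slice_poly_sum (R : realType) (n k : nat) (I : eqType) (s : seq I)
    (g : I -> cube n -> R) :
  (forall i, i \in s -> slice_poly k (g i)) ->
  slice_poly k (fun x => \sum_(i <- s) g i x).
Proof.
elim: s => [|i s IHs] gs.
  exists 0; first by rewrite size_poly0.
  by move=> t _; rewrite horner0 mulr0 big1 // => x _; rewrite big_nil.
apply: slice_poly_ext (fun x => esym (big_cons _ _ _ _ _ _)) _ => /=.
apply: slice_polyD; first by apply: gs; rewrite mem_head.
by apply: IHs => j js; apply: gs; rewrite inE js orbT.
Qed.

(** With a = |A|, the average is C(n - a, t - a) / C(n, t) = C(t, a) / C(n, a) for a <= t, and both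
    C(t, a) and the average vanish for t < a. *)
Lemma slice_poly_monomial (R : realType) (n : nat) (A : {set 'I_n}) :
  slice_poly #|A| (fun x => \prod_(i in A) (x i)%:R : R).
Proof.
have le_An : (#|A| <= n)%N by rewrite -[leqRHS]card_ord max_card.
exists (('C(n, #|A|)%:R)^-1 *: binom_poly 'X #|A|).
  by rewrite (leq_trans (size_scale_leq _ _)) // size_binom_poly ?size_polyX.
move=> t le_tn; rewrite sum_slice_monomial hornerZ.
rewrite (@horner_binom_poly _ _ _ _ t) ?hornerX //.
case: ltnP => [lt_tA|le_At]; first by rewrite (bin_small lt_tA) mulr0n !mulr0.
rewrite mulrCA -natrM -bin_subset_of_subset ?le_At // natrM mulKf //.
by rewrite pnatr_eq0 -lt0n bin_gt0.
Qed.

(** Induction on [s], with [A] collecting the coordinates already treated. Each new factor is x_i or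
    1 - x_i, and since x_i^2 = x_i, multiplying by x_i amounts to adding i to [A]. *)
Lemma slice_poly_flipped_prod (R : realType) (n : nat) (a : cube n)
    (s : seq 'I_n) (A : {set 'I_n}) :
  slice_poly (#|A| + size s)
    (fun x => \prod_(i in A) (x i)%:R * \prod_(i <- s) (a i (+) x i)%:R : R).
Proof.
elim: s A => [|i s IHs] A.
  rewrite addn0; apply: slice_poly_ext (slice_poly_monomial R A) => x.
  by rewrite big_nil mulr1.
have monoE (x : cube n) : \prod_(j in i |: A) (x j)%:R =
    (x i)%:R * \prod_(j in A) (x j)%:R :> R.
  have [iA|iA] := boolP (i \in A); last by rewrite big_setU1.
  rewrite (finset.setUidPr _) ?finset.sub1set // (big_setD1 i iA) /= mulrA -natrM.
  by case: (x i).
have IHi : slice_poly (#|A| + (size s).+1) (fun x : cube n =>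
    \prod_(j in i |: A) (x j)%:R * \prod_(j <- s) (a j (+) x j)%:R : R).
  apply: slice_poly_le (IHs _).
  by rewrite cardsU1 -addnA addnS -add1n leq_add2r leq_b1.
have IHA := slice_poly_le (leq_add (leqnn _) (leqnSn _)) (IHs A).
case ai: (a i); last first.
  by apply: slice_poly_ext IHi => x; rewrite monoE big_cons ai mulrCA mulrA.
apply: slice_poly_ext (slice_polyD IHA (slice_polyZ (-1) IHi)) => x.
by rewrite monoE big_cons ai /=; case: (x i) => /=; ring.
Qed.

(** Positive powers of 0/1 values collapse, so a monomial [m] becomes the product over its support,
    which has at most [mdeg m < msize f] elements. *)
Lemma slice_poly_cube_eval (R : realType) (n d : nat) (f : {mpoly R[n]})
    (a : cube n) :
  (msize f <= d.+1)%N -> slice_poly d (fun x => cube_eval f (cube_flip a x)).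
Proof.
move=> size_f.
apply: slice_poly_ext (fun x => esym (mevalE _ _)) _ => /=.
apply: slice_poly_sum => m m_supp; apply: slice_polyZ.
have := slice_poly_flipped_prod R a [seq i <- enum 'I_n | 0 < m i]%N finset.set0.
rewrite cards0 add0n => sp.
have {}sp := slice_poly_le _ sp; apply: slice_poly_ext (sp d _) => [x|].
  rewrite big_set0 mul1r big_filter big_enum_cond big_mkcond /=.
  apply: eq_bigr => i _; rewrite ffunE; case: (a i (+) x i) => /=.
    by rewrite expr1n if_same.
  by rewrite expr0n lt0n; case: eqP.
rewrite -ltnS; apply: leq_trans size_f; apply: leq_ltn_trans (msize_mdeg_lt m_supp).
rewrite size_filter -sum1_count big_enum_cond mdegE big_mkcond /=.
by apply: leq_sum => i _; case: (m i).
Qed.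

(** * Bounding the inner Lasserre value by univariate multipliers *)

Lemma cube_eval_min (R : realType) (n : nat) (f : {mpoly R[n]}) :
  exists a : cube n, cube_eval f a = cube_min f.
Proof.
rewrite /cube_min; elim/big_ind: _ => [|u v [a <-] [b <-]|x _].
- by exists [ffun=> false].
- by rewrite minEle; case: ifP => _; [exists a | exists b].
- by exists x.
Qed.

Lemma cube_min_le (R : realType) (n : nat) (f : {mpoly R[n]}) (x : cube n) :
  cube_min f <= cube_eval f x.
Proof. exact: bigmin_le. Qed.

Lemma le_cube_norm (R : realType) (n : nat) (f : {mpoly R[n]}) (x : cube n) :
  `|cube_eval f x| <= cube_norm f.
Proof. exact: (le_bigmax _ (fun x : cube n => `|cube_eval f x|)). Qed.

Lemma cube_evalM (R : realType) (n : nat) (f g : {mpoly R[n]}) (x : cube n) :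
  cube_eval (f * g) x = cube_eval f x * cube_eval g x.
Proof. exact: mevalM. Qed.

Lemma sos_cube_eval_ge0 (R : realType) (n r : nat) (s : {mpoly R[n]}) (x : cube n) :
  sos r s -> 0 <= cube_eval s x.
Proof.
case=> ps [_ ->]; rewrite /cube_eval raddf_sum /=.
by apply: sumr_ge0 => p _; rewrite rmorphXn sqr_ge0.
Qed.

Lemma card_cube_gt0 (R : realType) (n : nat) : 0 < #|{: cube n}|%:R :> R.
Proof. by rewrite ltr0n; apply/card_gt0P; exists [ffun=> false]. Qed.

(** A feasible [s] is nonnegative on the cube with integral 1, so [cube_min f] bounds the feasible
    values from below and [inf] is a true infimum. *)
Lemma lasserre_inner_le (R : realType) (n r : nat) (f s : {mpoly R[n]}) :
  sos r s -> cube_integral s = 1 -> lasserre_inner f r <= cube_integral (f * s).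
Proof.
move=> sos_s int_s; apply: ge_inf; last by exists s.
exists (cube_min f) => _ [g [sos_g int_g] <-].
rewrite -[cube_min f]mulr1 -int_g /cube_integral mulrA.
rewrite ler_pM2r ?invr_gt0 ?card_cube_gt0 // mulr_sumr ler_sum // => x _.
by rewrite cube_evalM ler_wpM2r ?cube_min_le // (sos_cube_eval_ge0 x sos_g).
Qed.

Lemma msize_exp_le (R : idomainType) (n : nat) (l : {mpoly R[n]}) (j : nat) :
  (msize l <= 2)%N -> (msize (l ^+ j) <= j.+1)%N.
Proof.
move=> size_l; elim: j => [|j IHj]; first by rewrite expr0 msize1.
rewrite exprS; have [->|l_neq0] := eqVneq l 0; first by rewrite mul0r msize0.
rewrite msizeM ?expf_neq0 // -subn1 leq_subLR add1n.
by rewrite (leq_trans (leq_add size_l IHj)).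
Qed.

(** On the cube the Hamming distance to [a] is the sum of the terms x_i or 1 - x_i, of degree at
    most 1; [Q] is [q] composed with it. *)
Lemma distance_poly (R : realType) (n r : nat) (a : cube n) (q : {poly R}) :
  (size q <= r.+1)%N ->
  exists2 Q : {mpoly R[n]}, (msize Q <= r.+1)%N &
    forall x, cube_eval Q x = q.[(cube_weight (cube_flip a x))%:R].
Proof.
move=> size_q.
pose l : {mpoly R[n]} := \sum_i (if a i then 1 - 'X_i else 'X_i).
have size_l : (msize l <= 2)%N.
  apply: leq_trans (msize_sum _ _ _) _; apply/bigmax_leqP => i _.
  case: (a i); last by rewrite msizeX mdeg1.
  by rewrite (leq_trans (msizeD_le _ _)) // geq_max msizeN msize1 msizeX mdeg1.
have lE (x : cube n) : cube_eval l x = (cube_weight (cube_flip a x))%:R.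
  rewrite /cube_eval raddf_sum natr_sum /=; apply: eq_bigr => i _.
  rewrite ffunE; case: (a i); last by rewrite mevalXU.
  by rewrite mevalB meval1 mevalXU; case: (x i); rewrite ?subrr ?subr0.
exists (\sum_(j < r.+1) q`_j *: l ^+ j).
  apply: leq_trans (msize_sum _ _ _) _; apply/bigmax_leqP => j _.
  by rewrite (leq_trans (msizeZ_le _ _)) // (leq_trans (msize_exp_le _ size_l)).
move=> x; rewrite -lE (horner_coef_wide _ size_q) /cube_eval raddf_sum /=.
by apply: eq_bigr => j _; rewrite mevalZ rmorphXn.
Qed.

(* The right-hand side is the value of the program at the normalization of
   Q^2, with Q the composition of q and the Hamming distance to a. *)
Lemma lasserre_inner_le_moment (R : realType) (n r : nat) (f : {mpoly R[n]})
    (a : cube n) (q p : {poly R}) :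
  (size q <= r.+1)%N ->
  0 < \sum_(t < n.+1) 'C(n, t)%:R * q.[t%:R] ^+ 2 ->
  (forall t : nat, (t <= n)%N ->
    \sum_(x | cube_weight x == t) cube_eval f (cube_flip a x) =
    'C(n, t)%:R * p.[t%:R]) ->
  lasserre_inner f r <=
    (\sum_(t < n.+1) 'C(n, t)%:R * q.[t%:R] ^+ 2 * p.[t%:R]) /
    (\sum_(t < n.+1) 'C(n, t)%:R * q.[t%:R] ^+ 2).
Proof.
move=> size_q; set N := \sum_(t < _) _ * _ => N_gt0 pE.
have [Q size_Q QE] := distance_poly a size_q.
(* The substitution by [cube_flip a] turns distance to [a] into weight, so that the sum can be
   sliced. *)
have flip_sum (g : cube n -> R) :
    \sum_x g x * cube_eval Q x ^+ 2 =
    \sum_(t < n.+1) q.[t%:R] ^+ 2 * \sum_(x | cube_weight x == t) g (cube_flip a x).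
  rewrite (reindex_inj (inv_inj (cube_flipK a))) /=.
  rewrite -(sum_cube_slices (fun x => g (cube_flip a x)) (fun t => q.[t%:R] ^+ 2)).
  by apply: eq_bigr => x _; rewrite QE cube_flipK.
have sumQ : \sum_(x : cube n) cube_eval Q x ^+ 2 = N.
  have := flip_sum (fun=> 1); rewrite (eq_bigr (fun x => cube_eval Q x ^+ 2)).
    move=> ->; apply: eq_bigr => t _.
    by rewrite card_slice mulrC.
  by move=> x _; rewrite mul1r.
have sumfQ : \sum_(x : cube n) cube_eval f x * cube_eval Q x ^+ 2 =
    \sum_(t < n.+1) 'C(n, t)%:R * q.[t%:R] ^+ 2 * p.[t%:R].
  rewrite flip_sum; apply: eq_bigr => t _.
  by rewrite pE -1?ltnS // mulrA [_ * 'C(_, _)%:R]mulrC.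
set V : R := #|{: cube n}|%:R; have V_gt0 : 0 < V := card_cube_gt0 R n.
(* Chosen so that the integral of (c Q)^2, which is c^2 N / V, equals 1. *)
pose c := Num.sqrt (V / N).
have c2 : c ^+ 2 = V / N by rewrite sqr_sqrtr // ltW // divr_gt0.
have sE (x : cube n) : cube_eval ((c *: Q) ^+ 2) x = V / N * cube_eval Q x ^+ 2.
  by rewrite /cube_eval rmorphXn /= mevalZ exprMn c2.
have sos_s : sos r ((c *: Q) ^+ 2).
  exists [:: c *: Q]; rewrite big_seq1; split=> // P; rewrite inE => /eqP ->.
  exact: leq_trans (msizeZ_le _ _) _.
have int_s : cube_integral ((c *: Q) ^+ 2) = 1.
  rewrite /cube_integral (eq_bigr _ (fun x _ => sE x)) -mulr_sumr sumQ -/V.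
  by field; rewrite !gt_eqF.
apply: le_trans (lasserre_inner_le f sos_s int_s) _.
rewrite /cube_integral (eq_bigr (fun x => V / N * (cube_eval f x * cube_eval Q x ^+ 2))).
  rewrite -mulr_sumr sumfQ -/V le_eqVlt; apply/orP; left; apply/eqP.
  by field; rewrite !gt_eqF.
by move=> x _; rewrite cube_evalM sE mulrCA.
Qed.

(** * The gap estimate and the final constant *)

(** Nonnegativity of the root is recorded too, since it allows [A] to be enlarged later; it holds
    because xi N is a sum of nonnegative terms and N > 0. *)
Lemma lasserre_inner_gap (R : realType) (d : nat) :
  exists2 A : R, 0 <= A & forall (n r : nat) (f : {mpoly R[n]}),
    (0 < n)%N -> (d <= n)%N -> (r < n)%N -> (msize f <= d.+1)%N ->
    lasserre_inner f r - cube_min f <=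
      A * cube_norm f * (krawtchouk_least_root R n r.+1 / n%:R) /\
    0 <= krawtchouk_least_root R n r.+1.
Proof.
have [A A_ge0 lip] := poly_discrete_lipschitz R d.
exists A => // n r f n_gt0 le_dn lt_rn size_f.
set xi := krawtchouk_least_root _ _ _; set M := cube_norm f.
have [a fa] := cube_eval_min f.
have [p size_p pE] := slice_poly_cube_eval a size_f.
have [q [size_q N_gt0 qE]] := krawtchouk_multiplier R lt_rn.
have := lasserre_inner_le_moment size_q N_gt0 pE.
move: N_gt0 qE; set N := \sum_(t < _) _ * _ ^+ 2 => N_gt0 qE le_inner.
have C_gt0 t : (t <= n)%N -> 0 < 'C(n, t)%:R :> R by move=> ?; rewrite ltr0n bin_gt0.
have ge0 (t : 'I_n.+1) : 0 <= 'C(n, t)%:R * q.[t%:R] ^+ 2.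
  by rewrite mulr_ge0 ?sqr_ge0.
have pM t : (t <= n)%N -> `|p.[t%:R]| <= M.
  move=> le_tn; rewrite -(ler_pM2l (C_gt0 t le_tn)).
  rewrite -{1}[X in X * `|_|](gtr0_norm (C_gt0 t le_tn)) -normrM -pE //.
  rewrite -card_slice mulr_suml (le_trans (ler_norm_sum _ _ _)) //.
  by apply: ler_sum => x _; rewrite mul1r le_cube_norm.
(* The sphere of radius 0 around the minimizer [a] is [a] alone. *)
have p0 : p.[0] = cube_min f.
  have := pE 0%N isT; rewrite bin0 mul1r => <-.
  rewrite (big_pred1 [ffun=> false]) => [|x] /=.
    by rewrite -fa; congr cube_eval; apply/ffunP => i; rewrite !ffunE addbF.
  rewrite /cube_weight sum_nat_eq0; apply/forallP/eqP => [x0|-> i].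
    by apply/ffunP => i; have := x0 i; rewrite ffunE; case: (x i).
  by rewrite ffunE.
split.
  (* After clearing N, the Lipschitz bound applies term by term, and the weighted sum of t is xi N
     by the choice of [q]. *)
  apply: le_trans (lerB le_inner (lexx _)) _.
  rewrite -p0 -[X in _ - X](mulfK (lt0r_neq0 N_gt0)) -mulrBl ler_pdivrMr //.
  rewrite [leRHS](_ : _ = A * M / n%:R * (xi * N)); last by ring.
  rewrite [p.[0] * N]mulrC mulr_suml -sumrB -qE mulr_sumr ler_sum // => t _.
  rewrite -mulrBr [leRHS]mulrCA ler_wpM2l // (le_trans (lip n p M _ _ _ pM t _)) -1?ltnS //.
  by rewrite mulrA mulrAC.
by rewrite -(pmulr_lge0 _ N_gt0) -qE sumr_ge0 // => t _; rewrite mulr_ge0.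
Qed.

Theorem theorem3 (R : realType) (d : nat) :
  exists C : R, 0 < C /\
    forall (n r : nat) (f : {mpoly R[n]}),
      (1 <= n)%N -> (d <= n)%N ->
      (r.+1)%:R / n%:R <= (1 / 2%:R : R) ->
      msize f = d.+1 ->
      (exists x : cube n, cube_eval f x != 0) ->
      (lasserre_inner f r - cube_min f) / cube_norm f
        <= C * (krawtchouk_least_root R n r.+1 / n%:R).
Proof.
have [A A_ge0 gap] := lasserre_inner_gap R d.
(* [A] may be 0, whereas the constant must be positive. *)
exists (A + 1); split; first by rewrite ltr_wpDl.
move=> n r f n_gt0 le_dn r_half size_f [x fx_neq0].
have nR_gt0 : 0 < n%:R :> R by rewrite ltr0n.
(* From r + 1 <= n / 2 <= n, the index r + 1 is in the range where the least root exists. *)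
have lt_rn : (r < n)%N.
  rewrite -(ler_nat R); move: r_half; rewrite ler_pdivrMr // => r_half.
  by apply: le_trans r_half _; rewrite mul1r ler_piMl ?invf_le1 ?ler0n ?ler1n.
have M_gt0 : 0 < cube_norm f by rewrite (lt_le_trans _ (le_cube_norm f x)) ?normr_gt0.
have [|gap_le xi_ge0] := gap n r f n_gt0 le_dn lt_rn; first by rewrite size_f.
rewrite ler_pdivrMr // mulrAC; apply: le_trans gap_le _.
rewrite ler_wpM2r ?divr_ge0 ?ler0n // ler_wpM2r ?(ltW M_gt0) //.
by rewrite lerDl ler01.
Qed.
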